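(* There is an absolute constant $C$ such that the following holds. Let $f:\{0,1\}^n\to\{0,1\}$ be a balanced boolean function chosen uniformly at random among all balanced boolean functions. Then, with probability tending to $1$ as $n\to\infty$, there exists a mapping $\phi:\{0,1\}^n\to\{0,1\}^n$ from $\mathrm{Dictator}$ to $f$ such that $\mathrm{dist}(x,\phi(x))\le C$ for all $x\in\{0,1\}^n$. In particular, such $\phi$ is $(2C+1)$-bi-Lipschitz.
   Context: $\mathrm{dist}$ is Hamming distance on $\{0,1\}^n$. $\mathrm{Dictator}(x)=x_1$. A boolean function $g$ is balanced if $|g^{-1}(0)|=|g^{-1}(1)|$. A mapping from $f$ to $g$ is a bijection $\phi$ of $\{0,1\}^n$ with $f(x)=g(\phi(x))$ for all $x$. A bijection $\phi$ is $C'$-bi-Lipschitz if both $\phi$ and $\phi^{-1}$ satisfy $\mathrm{dist}(\psi(x),\psi(y))\le C'\mathrm{dist}(x,y)$ for all $x,y$. *)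

(* Defs.v *)
From mathcomp Require Import all_boot all_order all_fingroup all_algebra.
From mathcomp Require Import all_classical all_reals all_analysis.

Set Implicit Arguments.
Unset Strict Implicit.
Unset Printing Implicit Defensive.

Import GRing.Theory.

Definition cube (n : nat) : finType := {ffun 'I_n -> bool}.

Definition boolfun (n : nat) : finType := {ffun cube n -> bool}.

Definition dist (n : nat) (x y : cube n) : nat := #|[pred i | x i != y i]|.

(* The first coordinate has index [ord0], so the dimension is [n.+1]. *)
Definition dictator (n : nat) : boolfun n.+1 := [ffun x : cube n.+1 => x ord0].

Definition balanced (n : nat) (f : boolfun n) : bool :=
  #|[pred x | f x == false]| == #|[pred x | f x == true]|.

Definition is_mapping (n : nat) (f g : boolfun n) (phi : {perm cube n}) : Prop :=
  forall x : cube n, f x = g (phi x).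

Definition lipschitz_map (n k : nat) (psi : cube n -> cube n) : Prop :=
  forall x y : cube n, (dist (psi x) (psi y) <= k * dist x y)%N.

Definition bilipschitz (n k : nat) (phi : {perm cube n}) : Prop :=
  lipschitz_map k phi /\ lipschitz_map k (phi^-1)%g.

(* Probability of [E] under the uniform distribution on balanced functions;
   the denominator is nonzero as soon as [0 < n]. *)
Definition pr_balanced (R : realType) (n : nat) (E : boolfun n -> Prop) : R :=
  (#|[pred f : boolfun n | balanced f && `[< E f >]]|%:R /
   #|[pred f : boolfun n | balanced f]|%:R)%R.

(* Main.v *)
(* By Hall's theorem applied to each colour class it suffices that
   |X| <= 2 |N_18(X) n f^-1(c)| for every set X and colour c; the last unit of
   displacement pays for the factor 2, because X together with its flip in the
   first coordinate has 2 |X| elements when X lies in a half-cube.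

   Such sets X are too many for a union bound, so X is replaced by N_8(S) for a
   maximal S in X with pairwise distances > 8. Since the radius-4 balls around S
   are disjoint, N_9(S) has at least |S| C(n, 4) points, and a Chernoff bound
   shows that f is balanced up to a factor 1 +- 1/(4n) on all sets N_9(S) at
   once: there are at most 2^(n |S|) sets S of a given size, while each fails
   with probability exp(-Omega(|S| C(n, 4) / n^2)). The expansion factor
   1 + 1/(2n) of sets of at most half the cube absorbs this error; for larger
   sets one argues with the complement of N_18(X). Conditioning on f being
   balanced costs only a factor 2^n. *)
Require Import Defs.
From mathcomp Require Import all_boot all_order all_fingroup all_algebra.
From mathcomp Require Import all_classical all_reals all_analysis.
From mathcomp Require Import fintype finset zify ring lra.
Import numFieldNormedType.Exports.

Set Implicit Arguments.
Unset Strict Implicit.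
Unset Printing Implicit Defensive.

Import Order.TTheory GRing.Theory Num.Theory.

(** * Hall's marriage theorem *)

(** Induction on [#|D|]. If some nonempty proper [X] is tight (no more neighbours than elements),
    then [X] and [D :\: X] are matched separately. Otherwise every nonempty proper subset has a
    neighbour to spare, so any edge [x0], [y0] can be fixed first. [u0] is the value of [g] when [D]
    is empty. *)
Lemma hall (T U : finType) (r : T -> U -> bool) (u0 : U)
    (D : {set T}) (E : {set U}) :
  (forall X : {set T}, X \subset D ->
     #|X| <= #|[set y in E | [exists x in X, r x y]]|) ->
  exists g : T -> U,
    {in D &, injective g} /\ {in D, forall x, g x \in E /\ r x (g x)}.
Proof.
have [m] := ubnP #|D|; elim: m D E => // m IHm D E ltDm hallD.
have [D0|[x0 Dx0]] := set_0Vmem D.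
  by exists (fun=> u0); rewrite D0; split=> [x y|x]; rewrite inE.
pose nb (E' : {set U}) (X : {set T}) := [set y in E' | [exists x in X, r x y]].
have [/existsP[X /and3P[propX X_neq0 tightX]]|loose] :=
  boolP [exists X : {set T}, [&& X \proper D, X != set0 & #|nb E X| <= #|X|]].
  have [subXD ltXD] := (proper_sub propX, proper_card propX).
  have [Z subZX|g1 [inj1 g1P]] := IHm X (nb E X) (leq_trans ltXD ltDm).
    rewrite (leq_trans (hallD Z (subset_trans subZX subXD))) //.
    apply/subset_leq_card/subsetP => y;
      rewrite !inE => /andP[-> /existsP[x /andP[Zx rxy]]].
    rewrite andTb; apply/andP; split; apply/existsP; exists x;
      rewrite rxy andbT //.
    exact: (subsetP subZX).
  have ltDX : #|D :\: X| < m.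
    apply: (@leq_trans #|D|) ltDm; rewrite cardsD (setIidPr subXD).
    by rewrite ltn_subrL card_gt0 X_neq0 (leq_trans _ ltXD).
  have [Z subZ|g2 [inj2 g2P]] := IHm (D :\: X) (E :\: nb E X) ltDX.
    have ZXD : Z :|: X \subset D.
      by rewrite subUset subXD andbT (subset_trans subZ) ?subsetDl.
    have dZX : [disjoint Z & X].
      by rewrite disjoints_subset (subset_trans subZ) // setDE subsetIr.
    (* Hall's condition is applied to [Z :|: X]; by tightness, removing the neighbours of [X] costs
       at most [#|X|]. *)
    rewrite -(leq_add2r #|X|) -cardsUI.
    rewrite (disjoint_setI0 dZX) cards0 addn0 (leq_trans (hallD _ ZXD)) //.
    rewrite (leq_trans _ (leq_add (leqnn _) tightX)) //.
    rewrite (leq_trans _ (leq_card_setU _ _)) //.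
    apply/subset_leq_card/subsetP => y; rewrite !inE => /andP[Ey /existsP[x]].
    rewrite Ey inE /= => /andP[/orP[Zx|Xx] rxy].
      by case: [exists _ in X, _] => //=; rewrite orbF; apply/existsP; exists x;
        rewrite Zx.
    by apply/orP; right; apply/existsP; exists x; rewrite Xx.
  exists (fun x => if x \in X then g1 x else g2 x); split=> [x y Dx Dy|x Dx] /=.
    case: ifP => Xx; case: ifP => Xy eqg.
    - exact: inj1.
    - have [/= g2y _] : g2 y \in E :\: nb E X /\ r y (g2 y).
        by apply: g2P; rewrite inE Xy.
      by have [/= + _] := g1P x Xx; rewrite eqg; move: g2y;
        rewrite inE => /andP[/negP].
    - have [/= g2x _] : g2 x \in E :\: nb E X /\ r x (g2 x).
        by apply: g2P; rewrite inE Xx.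
      by have [/= + _] := g1P y Xy; rewrite -eqg; move: g2x;
        rewrite inE => /andP[/negP].
    - by apply: inj2; rewrite // inE ?Xx ?Xy.
  case: ifP => Xx; first by have [/=] := g1P x Xx; rewrite inE => /andP[].
  have [/=|] := g2P x; rewrite inE ?Xx //.
  by case/andP.
have [y0] : exists y0, y0 \in nb E [set x0].
  by apply/card_gt0P; rewrite (leq_trans _ (hallD _ _)) ?cards1 ?sub1set.
rewrite inE => /andP[Ey0 /existsP[_ /andP[/set1P -> rxy0]]].
have ltDx : #|D :\ x0| < m by rewrite (cardsD1 x0) Dx0 in ltDm.
have [Z subZ|g [injg gP]] := IHm (D :\ x0) (E :\ y0) ltDx.
  have [->|Z0] := eqVneq Z set0; first by rewrite cards0.
  have propZ : Z \proper D.
    by apply: sub_proper_trans subZ _; apply: properD1.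
  have : #|Z| < #|nb E Z|.
    rewrite ltnNge; apply: contra loose => tight.
    by apply/existsP; exists Z; rewrite propZ Z0.
  rewrite (cardsD1 y0) => /leq_trans; rewrite -ltnS; apply.
  rewrite -add1n leq_add ?leq_b1 //.
  by apply/subset_leq_card/subsetP => y; rewrite !inE andbA.
exists (fun x => if x == x0 then y0 else g x); split=> [x y Dx Dy|x Dx] /=.
  have gy0 z : z \in D -> z != x0 -> g z != y0.
    by move=> Dz zx; have [] := gP z; rewrite !inE ?zx // => /andP[].
  case: (eqVneq x x0) => [->|xx0]; case: (eqVneq y x0) => [->|yx0] // eqg.
  - by have := gy0 y Dy yx0; rewrite -eqg eqxx.
  - by have := gy0 x Dx xx0; rewrite eqg eqxx.
  - by apply: injg; rewrite // !inE ?xx0 ?yx0.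
case: (eqVneq x x0) => [->|xx0] //.
by have [] := gP x; rewrite !inE ?xx0 // => /andP[].
Qed.

(** * Neighbourhoods and separated sets in the Hamming cube *)

Definition cube_add n (x v : cube n) : cube n := [ffun i => x i (+) v i].

Definition nbhd n r (X : {set cube n}) : {set cube n} :=
  [set y | [exists x in X, dist x y <= r]].

(** These are the codes whose minimum distance exceeds [r]. *)
Definition scattered n r (S : {set cube n}) : bool :=
  [forall x in S, forall y in S, (dist x y <= r) ==> (x == y)].

Lemma card_cube n : #|cube n| = 2 ^ n.
Proof. by rewrite card_ffun card_bool card_ord. Qed.

Lemma dist_xx n (x : cube n) : dist x x = 0.
Proof. by rewrite /dist eq_card0 // => i; rewrite !inE eqxx. Qed.

Lemma dist_sym n (x y : cube n) : dist x y = dist y x.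
Proof. by apply: eq_card => i; rewrite !inE eq_sym. Qed.

Lemma dist_triangle n (x y z : cube n) : dist x z <= dist x y + dist y z.
Proof.
rewrite /dist -cardUI (leq_trans _ (leq_addr _ _)) //.
apply/subset_leq_card/subsetP => i; rewrite !inE.
by apply: contraR; rewrite negb_or !negbK => /andP[/eqP -> /eqP ->].
Qed.

Lemma dist_gt0 n (x y : cube n) : x != y -> 0 < dist x y.
Proof.
apply: contraNT; rewrite -leqNgt leqn0 => /eqP/card0_eq d0.
by apply/eqP/ffunP => i; have := d0 i; rewrite !inE => /negbFE/eqP.
Qed.

Lemma cube_addKl n (x : cube n) : involutive (cube_add x).
Proof. by move=> v; apply/ffunP => i; rewrite !ffunE addbA addbb. Qed.

Lemma cube_addKr n (v : cube n) : involutive (fun x => cube_add x v).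
Proof. by move=> x; apply/ffunP => i; rewrite !ffunE -addbA addbb addbF. Qed.

Lemma mem_nbhd n r (X : {set cube n}) x y :
  x \in X -> dist x y <= r -> y \in nbhd r X.
Proof. by move=> Xx xy; rewrite inE; apply/existsP; exists x; rewrite Xx. Qed.

Lemma nbhdP n r (X : {set cube n}) y :
  reflect (exists2 x, x \in X & dist x y <= r) (y \in nbhd r X).
Proof. by rewrite inE; apply: exists_inP. Qed.

Lemma sub_nbhd n r (X : {set cube n}) : X \subset nbhd r X.
Proof. by apply/subsetP => x Xx; apply: mem_nbhd Xx _; rewrite dist_xx. Qed.

Lemma nbhdS n r (X Y : {set cube n}) : X \subset Y -> nbhd r X \subset nbhd r Y.
Proof.
move/subsetP => XY; apply/subsetP => y /nbhdP[x Xx]; apply: mem_nbhd.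
exact: XY.
Qed.

Lemma nbhd_le n r s (X : {set cube n}) : r <= s -> nbhd r X \subset nbhd s X.
Proof.
move=> rs; apply/subsetP => y /nbhdP[x Xx xy]; apply: mem_nbhd Xx _.
exact: leq_trans rs.
Qed.

Lemma nbhd_nbhd n r s (X : {set cube n}) :
  nbhd r (nbhd s X) \subset nbhd (s + r) X.
Proof.
apply/subsetP => z /nbhdP[y /nbhdP[x Xx xy] yz]; apply: mem_nbhd Xx _.
by rewrite (leq_trans (dist_triangle x y z)) // leq_add.
Qed.

Lemma scatteredP n r (S : {set cube n}) :
  reflect {in S &, forall x y, dist x y <= r -> x = y} (scattered r S).
Proof.
apply: (iffP forall_inP) => [sep x y Sx Sy xy | sep x Sx].
  by apply/eqP/(implyP (forall_inP (sep x Sx) y Sy)).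
by apply/forall_inP => y Sy; apply/implyP => xy; apply/eqP/sep.
Qed.

(** A maximal [S] works: a point of [X] farther than [r] from all of [S] could be added to it. *)
Lemma scattered_hull n r (X : {set cube n}) :
  exists2 S : {set cube n}, (S \subset X) && scattered r S & X \subset nbhd r S.
Proof.
have [|S /maxsetP[/andP[SX sepS] maxS] _] :=
    @maxset_exists _ (fun S => (S \subset X) && scattered r S) set0.
  by rewrite sub0set /=; apply/scatteredP => x y; rewrite inE.
exists S; first by rewrite SX.
apply/subsetP => x Xx; apply/negPn/negP => farx.
have far y : y \in S -> dist y x <= r -> False.
  by move=> Sy yx; rewrite (mem_nbhd Sy yx) in farx.
have /maxS defS : (x |: S \subset X) && scattered r (x |: S).
  rewrite subUset sub1set Xx SX /=; apply/scatteredP => y z.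
  rewrite !inE => /orP[/eqP->|Sy] /orP[/eqP->|Sz] //.
  - by rewrite dist_sym => /far-/(_ Sz).
  - by move/far => /(_ Sy).
  - exact: (scatteredP _ _ sepS).
by rewrite -defS ?subsetUr ?setU11 // (subsetP (sub_nbhd r _)) ?setU11 in farx.
Qed.

Lemma dist_cube_add n (x v : cube n) : dist x (cube_add x v) = #|[pred i | v i]|.
Proof.
by apply: eq_card => i; rewrite !inE ffunE; case: (x i); case: (v i).
Qed.

(** The spheres of radius [r] about points of [S] are disjoint, and each has C(n, r) points, one for
    every [r]-set of coordinates to flip. *)
Lemma card_nbhd_scattered n r s (S : {set cube n}) :
  r + r <= s -> scattered s S -> #|S| * 'C(n, r) <= #|nbhd r S|.
Proof.
move=> rs /scatteredP sepS.
pose ind (A : {set 'I_n}) : cube n := [ffun i => i \in A].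
pose D := finset.setX S [set A : {set 'I_n} | #|A| == r].
pose sh (p : cube n * {set 'I_n}) := cube_add p.1 (ind p.2).
have dist_sh p : p \in D -> dist p.1 (sh p) = r.
  rewrite !inE => /andP[_ /eqP <-]; rewrite dist_cube_add.
  by apply: eq_card => i; rewrite !inE ffunE.
have sh_inj : {in D &, injective sh}.
  move=> p q Dp Dq eqsh; have [dp dq] := (dist_sh p Dp, dist_sh q Dq).
  have eq1 : p.1 = q.1.
    apply: sepS; try by move: Dp Dq; rewrite !inE => /andP[? _] /andP[? _].
    rewrite (leq_trans (dist_triangle _ (sh p) _)) // dp eqsh dist_sym dq //.
  rewrite [p]surjective_pairing [q]surjective_pairing eq1; congr (_, _).
  move: eqsh; rewrite /sh eq1 => /(can_inj (@cube_addKl _ _))/ffunP eqi.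
  by apply/setP => i; have := eqi i; rewrite !ffunE.
have -> : #|S| * 'C(n, r) = #|D| by rewrite cardsX card_draws card_ord.
rewrite -(card_in_imset sh_inj);
  apply/subset_leq_card/subsetP => _ /imsetP[p Dp ->].
by apply: (@mem_nbhd _ _ _ p.1);
  [move: Dp; rewrite !inE => /andP[] | rewrite dist_sh].
Qed.

(** * Vertex isoperimetry by translations *)

(** Walk from [x] to [x + v] one coordinate at a time. A walk that ends outside [X] first leaves it
    at a point of [nbhd 1 X :\: X]; for each of the [n] times, that point determines [x]. *)
Lemma card_leaving_translate n (X : {set cube n}) (v : cube n) :
  #|[set x in X | cube_add x v \notin X]| <= n * #|nbhd 1 X :\: X|.
Proof.
pose tr k : cube n := [ffun i : 'I_n => (i < k) && v i].
have tr0 x : cube_add x (tr 0) = x by apply/ffunP => i; rewrite !ffunE addbF.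
have trn : tr n = v by apply/ffunP => i; rewrite !ffunE ltn_ord.
have trS x k : dist (cube_add x (tr k)) (cube_add x (tr k.+1)) <= 1.
  apply/card_le1P => i; rewrite !inE !ffunE => ik j; rewrite !inE !ffunE.
  move: ik; rewrite !ltnS; case: (ltngtP i k) => //= ik; rewrite ?eqxx //.
  rewrite -val_eqE /= ik; case: (ltngtP j k) => //= jk; rewrite ?eqxx //.
  by rewrite (_ : j = i) //; apply: val_inj => /=; rewrite jk.
pose B k := [set x | cube_add x (tr k.+1) \in nbhd 1 X :\: X].
have cardB k : #|B k| = #|nbhd 1 X :\: X|.
  have -> : B k = (fun x => cube_add x (tr k.+1)) @^-1: (nbhd 1 X :\: X).
    by apply/setP => x; rewrite !inE.
  by rewrite card_preimset //; apply: can_inj (cube_addKr _).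
have subB x : x \in X -> cube_add x v \notin X -> exists k : 'I_n, x \in B k.
  move=> Xx; rewrite -trn.
  have: forall m, m <= n -> cube_add x (tr m) \notin X -> exists k : 'I_n, x \in B k.
    elim=> [|m IHm] ltmn; first by rewrite tr0 Xx.
    move=> nX; have [Xm|/(IHm (ltnW ltmn))//] :=
      boolP (cube_add x (tr m) \in X).
    exists (Ordinal ltmn); rewrite inE finset.in_setD nX /=.
    exact: mem_nbhd Xm (trS _ _).
  exact.
apply: (@leq_trans (\sum_(k < n) #|B k|)); last first.
  by under eq_bigr => k _ do rewrite cardB; rewrite sum_nat_const card_ord.
rewrite (eq_bigr (fun k : 'I_n => \sum_x (x \in B k))); last first.
  by move=> k _; rewrite -sum1_card big_mkcond.
rewrite exchange_big -sum1_card big_mkcond; apply: leq_sum => x _ /=.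
rewrite inE; case: ifP => // /andP[Xx nX].
by have [k Bk] := subB x Xx nX; rewrite (bigD1 k) //= Bk.
Qed.

(* Averaging over all translates: some v moves half of X out of X, and v is a
   sum of at most n unit vectors. *)
Lemma vertex_isoperimetry n (X : {set cube n}) :
  2 * #|X| <= 2 ^ n -> (2 * n).+1 * #|X| <= 2 * n * #|nbhd 1 X|.
Proof.
move=> smallX.
(* Double counting: each [x] in [X] is moved out of [X] by exactly [2 ^ n - #|X|] vectors [v]. *)
have : \sum_v #|[set x in X | cube_add x v \notin X]| = #|X| * (2 ^ n - #|X|).
  have cardE v : #|[set x in X | cube_add x v \notin X]|
               = \sum_(x | (x \in X) && (cube_add x v \notin X)) 1.
    by rewrite -sum1_card; apply: eq_bigl => x; rewrite inE.
  under eq_bigr => v _ do rewrite cardE.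
  rewrite (exchange_big_dep (mem X)) /=; last by move=> v x _ /andP[].
  rewrite -sum_nat_const; apply: eq_bigr => x Xx.
  rewrite -card_cube -(cardsC X) addKn sum1_card.
  rewrite -(card_preimset (f := cube_add x) (~: X));
    last exact: can_inj (cube_addKl x).
  by apply: eq_card => v; rewrite !inE Xx.
have le_sum : \sum_v #|[set x in X | cube_add x v \notin X]|
             <= 2 ^ n * (n * #|nbhd 1 X :\: X|).
  rewrite -card_cube -sum_nat_const; apply: leq_sum => v _.
  exact: card_leaving_translate.
have eqN : #|nbhd 1 X| = #|X| + #|nbhd 1 X :\: X|.
  by rewrite -(cardsID X (nbhd 1 X)) (setIidPr (sub_nbhd 1 X)).
move=> sumE; rewrite sumE in le_sum.
have N0 : 0 < 2 ^ n by rewrite expn_gt0.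
have leX : #|X| <= 2 * (n * #|nbhd 1 X :\: X|).
  rewrite -(leq_pmul2l N0).
  have half : 2 ^ n * #|X| <= 2 * (#|X| * (2 ^ n - #|X|)).
    by rewrite [2 ^ n * _]mulnC mulnCA leq_mul2l; apply/orP; right; lia.
  by apply: leq_trans half _; rewrite [2 ^ n * _]mulnCA leq_mul2l.
by rewrite eqN mulSn mulnDr addnC leq_add2l -mulnA.
Qed.

(** * A Chernoff bound for one colour on a fixed set *)

Lemma bernoulli (F : realFieldType) (x : F) n :
  (-1 <= x -> 1 + x *+ n <= (1 + x) ^+ n)%R.
Proof.
move=> x_ge; elim: n => [|n IHn]; first by rewrite mulr0n addr0 expr0.
rewrite exprS; apply: le_trans (ler_wpM2l _ IHn); last by lra.
have : (0 <= x * (x *+ n))%R by rewrite mulrnAr mulrn_wge0 // -expr2 sqr_ge0.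
by rewrite mulrS; lra.
Qed.

(* With [s = 1/q] and [d = 2 a - t], the square of the left-hand side dominates
   [((1 - s^2) (1 + s)^(2 d / t))^t], where [d > t / q]. *)
Lemma biased_weight_ge (F : realFieldType) (q t a L : nat)
    (s := (q%:R^-1 : F)%R) :
  3 < q -> a <= t -> q.+1 * t < 2 * q * a -> 4 * q ^ 2 * L <= t ->
  (2 ^+ L <= (1 + s) ^+ a * (1 - s) ^+ (t - a))%R.
Proof.
move=> q_gt3 le_at big_a leLt; pose d := 2 * a - t.
have le_dq : t <= d * q by rewrite /d; nia.
have le_t2a : t <= 2 * a by nia.
have q_gt0 : (0 < q%:R :> F)%R by rewrite ltr0n; lia.
have qs : (q%:R * s = 1 :> F)%R by rewrite divff // gt_eqF.
have s_gt0 : (0 < s)%R by rewrite invr_gt0.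
have s_le : (4 * s <= 1)%R
  by rewrite -[leRHS]qs ler_wpM2r ?(ltW s_gt0) ?(ler_nat F 4).
pose u := (1 + s : F)%R; pose v := (1 - s : F)%R;
  pose x := (u ^+ a * v ^+ (t - a))%R.
have u_ge1 : (1 <= u)%R by rewrite /u; lra.
have u_ge0 : (0 <= u)%R by lra.
have v_ge0 : (0 <= v)%R by rewrite /v; lra.
have uv_ge0 : (0 <= u * v)%R by rewrite mulr_ge0.
have uv_le1 : (u * v <= 1)%R by rewrite /u /v; nra.
have x_ge0 : (0 <= x)%R by rewrite mulr_ge0 ?exprn_ge0.
have x2 : ((u * v) ^+ t * u ^+ (2 * d) <= x ^+ 2)%R.
  have -> : ((u * v) ^+ t * u ^+ (2 * d) = x ^+ 2 * (u * v) ^+ d)%R.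
    rewrite /x !exprMn -!exprM mulrACA -!exprD mulrAC -exprD.
    by congr (u ^+ _ * v ^+ _)%R; rewrite /d; clear -le_at le_t2a; lia.
  by rewrite ler_piMr ?exprn_ge0 // exprn_ile1.
(* The power [q] clears the fractional exponent: [t <= d * q] turns [u ^+ (2 * d)] into at least
   [u ^+ (2 * t)], and Bernoulli gives (1 - s^2)^q >= 1 - s. *)
have xq : (((1 - s) * u ^+ 2) ^+ t <= x ^+ (2 * q))%R.
  rewrite exprM; apply: le_trans (lerXn2r q _ _ x2);
    rewrite ?nnegrE ?mulr_ge0 ?exprn_ge0 //.
  rewrite [leRHS]exprMn -!exprM [t * q]mulnC exprM [leLHS]exprMn.
  apply: ler_pM; rewrite ?exprn_ge0 //.
    rewrite -/v lerXn2r ?nnegrE ?exprn_ge0 //.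
    have -> : (u * v = 1 + - s ^+ 2)%R by rewrite /u /v; ring.
    apply: le_trans (bernoulli _ _); last by nra.
    by rewrite mulNrn -mulr_natl expr2 mulrA qs mul1r.
  by rewrite -exprM ler_weXn2l // -mulnA leq_mul2l.
have gain : (1 + s / 2 <= (1 - s) * u ^+ 2)%R by rewrite /u; nra.
(* A further power 2q suffices, since (1 + s/2)^(2q) >= 1 + qs = 2. *)
have x4q2 : (2 ^+ t <= x ^+ (4 * q ^ 2))%R.
  have -> : 4 * q ^ 2 = (2 * q) * (2 * q) by rewrite mulnn expnMn.
  rewrite exprM; apply: le_trans (lerXn2r (2 * q) _ _ xq);
    rewrite ?nnegrE ?exprn_ge0 ?mulr_ge0 ?exprn_ge0 //.
  rewrite -exprM mulnC exprM lerXn2r ?nnegrE ?exprn_ge0 ?mulr_ge0 ?exprn_ge0 //.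
  apply: le_trans (lerXn2r (2 * q) _ _ gain);
    rewrite ?nnegrE ?mulr_ge0 ?exprn_ge0 //; last by lra.
  apply: le_trans (bernoulli _ _); last by lra.
  rewrite -[((s / 2) *+ _)%R]mulr_natl natrM;
    have -> : (2 * q%:R * (s / 2) = q%:R * s :> F)%R by field.
  by rewrite qs; lra.
have Q_gt0 : 0 < 4 * q ^ 2 by rewrite muln_gt0 expn_gt0 (ltn_trans _ q_gt3).
rewrite -(ler_pXn2r Q_gt0) ?nnegrE ?exprn_ge0 //.
by apply: le_trans x4q2; rewrite -exprM ler_weXn2l ?ler1n // mulnC.
Qed.

(** Exponential moments: a point of [V] has weight 1 + s if its colour is [c] and 1 - s otherwise.
    The two weights sum to 2, so all functions together weigh [2 ^ #|T|], while each function in the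
    set weighs at least [2 ^ L]. *)
Lemma large_deviation (T : finType) (V : {set T}) (c : bool) (q L : nat) :
  3 < q -> 4 * q ^ 2 * L <= #|V| ->
  #|[set f : {ffun T -> bool} |
      q.+1 * #|V| < 2 * q * #|[set x in V | f x == c]|]| * 2 ^ L <= 2 ^ #|T|.
Proof.
move=> q_gt3 leLV; set B := finset _.
pose s := (q%:R^-1 : rat)%R.
pose w x b : rat := (if x \in V then if b == c then 1 + s else 1 - s else 1)%R.
have s_le1 : (s <= 1)%R by rewrite invf_le1 ?ler1n ?ltr0n; lia.
have s_ge0 : (0 <= s)%R by rewrite invr_ge0.
have w_ge0 x b : (0 <= w x b)%R by rewrite /w; do 2?case: ifP; lra.
have sum_w : (\sum_(f : {ffun T -> bool}) \prod_x w x (f x) = 2 ^+ #|T|)%R.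
  rewrite -(bigA_distr_bigA w) -prodr_const; apply: eq_bigr => x _.
  by rewrite big_bool /w; case: (x \in V) => /=; case: (c) => /=; lra.
have w_ge (f : {ffun T -> bool}) : f \in B -> (2 ^+ L <= \prod_x w x (f x))%R.
  rewrite inE => big_f; have le_fV : #|[set x in V | f x == c]| <= #|V|.
    by apply/subset_leq_card/subsetP => x; rewrite inE => /andP[].
  apply: le_trans (biased_weight_ge _ q_gt3 le_fV big_f leLV) _.
  rewrite le_eqVlt; apply/orP; left; apply/eqP.
  rewrite -(cardsID [set x | f x == c] V).
  have -> : V :&: [set x | f x == c] = [set x in V | f x == c].
    by apply/setP => x; rewrite !inE.
  rewrite addKn -!prodr_const -/s big_mkcond [X in (_ * X)%R]big_mkcond -big_split.
  apply: eq_bigr => x _; rewrite /w !inE.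
  by case: (x \in V); case: (f x == c); rewrite /= ?mulr1 ?mul1r.
rewrite -(ler_nat rat) natrM !natrX -sum_w.
apply: (@le_trans _ _ (\sum_(f in B) \prod_x w x (f x))%R).
  by rewrite mulr_natl -sumr_const; apply: ler_sum.
rewrite [X in (_ <= X)%R](bigID (mem B)) /= lerDl sumr_ge0 // => f _.
exact: prodr_ge0.
Qed.

(** * Hall's condition for evenly spread functions *)

(* Only one side is required: the lower bound for [c] is the upper bound for
   [~~ c]. *)
Definition evenly_spread n (f : boolfun n) : bool :=
  [forall c : bool, forall S : {set cube n}, scattered 8 S ==>
    (2 * (4 * n) * #|[set x in nbhd 9 S | f x == c]|
       <= (4 * n).+1 * #|nbhd 9 S|)].

Lemma evenly_spreadP n (f : boolfun n) c (S : {set cube n}) :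
  evenly_spread f -> scattered 8 S ->
  2 * (4 * n) * #|[set x in nbhd 9 S | f x == c]| <= (4 * n).+1 * #|nbhd 9 S|.
Proof. by move=> /forallP/(_ c)/forallP/(_ S)/implyP. Qed.

Lemma card_split (T : finType) (f : T -> bool) c (X : {set T}) :
  #|[set x in X | f x == c]| + #|[set x in X | f x == ~~ c]| = #|X|.
Proof.
rewrite -(cardsID [set x | f x == c] X); congr (_ + _); apply: eq_card => x.
  by rewrite !inE.
by rewrite !inE andbC; case: (f x); case: c.
Qed.

Lemma card_filterS (T : finType) (P : pred T) (A B : {set T}) :
  A \subset B -> #|[set x in A | P x]| <= #|[set x in B | P x]|.
Proof.
by move=> AB; apply/subset_leq_card/subsetP => x;
  rewrite !inE => /andP[/(subsetP AB) -> ->].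
Qed.

Lemma balanced_card n (f : boolfun n) c :
  balanced f -> 2 * #|[set x | f x == c]| = 2 ^ n.
Proof.
move/eqP => bal; have := card_split f c setT; rewrite cardsT card_cube.
have E b : #|[set x in [set: cube n] | f x == b]| = #|[pred x | f x == b]|.
  by apply: eq_card => x; rewrite !inE.
have E' b : #|[set x | f x == b]| = #|[pred x | f x == b]|.
  by apply: eq_card => x; rewrite !inE.
by rewrite !E !E' mul2n -addnn => <-; case: c; rewrite /= bal.
Qed.

Lemma evenly_spread_hall n (f : boolfun n) c (X : {set cube n}) :
  0 < n -> balanced f -> evenly_spread f ->
  #|X| <= 2 * #|[set y in nbhd 18 X | f y == c]|.
Proof.
move=> n_gt0 bal spr.
have [S /andP[SX sepS] XS] := scattered_hull 8 X.
pose X1 := nbhd 8 S; apply: (leq_trans (subset_leq_card XS)); rewrite -/X1.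
have [smallX1|bigX1] := leqP (2 * #|X1|) (2 ^ n).
  apply: (@leq_trans (2 * #|[set y in nbhd 9 S | f y == c]|)); last first.
    by rewrite leq_mul2l card_filterS // (subset_trans (nbhdS 9 SX)) ?nbhd_le.
  have iso := vertex_isoperimetry smallX1.
  have := evenly_spreadP (~~ c) spr sepS.
  have := card_split f c (nbhd 9 S).
  have := subset_leq_card (nbhd_nbhd 1 8 S); rewrite -/X1 -[8 + 1]/9.
  move: #|nbhd 9 S| #|nbhd 1 X1| #|X1| iso => t t1 x1 iso le_t.
  set b := #|_|; set b' := #|_| => eqt le_b'.
  (* Expansion beats the colouring error because (4n - 1)(2n + 1) >= 8n^2. *)
  rewrite -(@leq_pmul2l (8 * n * n)); last by nia.
  have : (4 * n - 1) * t <= 8 * n * b by nia.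
  have : (4 * n - 1) * ((2 * n).+1 * x1) <= (4 * n - 1) * (2 * n * t).
    by rewrite leq_mul2l (leq_trans iso) ?orbT // leq_mul2l le_t orbT.
  nia.
(* For large [X1], it is enough that colour [c] occurs at most (2^n - |X1|)/2 times in [Y], as it
   occurs 2^(n-1) times in all. *)
pose Y := ~: nbhd 18 X.
have [S' /andP[S'Y sepS'] YS'] := scattered_hull 8 Y.
pose Y1 := nbhd 9 S'.
have YY1 : Y \subset Y1 := subset_trans YS' (nbhd_le S' (leqnSn 8)).
(* A common point would put a point of [S'] within 8 + 1 + 9 = 18 of [S], but [S'] avoids
   [nbhd 18 X]. *)
have disj : [disjoint X1 & nbhd 1 Y1].
  apply/pred0P => z;
    apply/negP => /andP[/nbhdP[x Sx xz] /nbhdP[y /nbhdP[y' Sy' y'y] yz]].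
  have := subsetP S'Y y' Sy'; rewrite finset.in_setC => /negP; apply.
  apply: (mem_nbhd (subsetP SX x Sx)).
  move: (dist_triangle x z y') (dist_triangle y' y z) xz y'y yz.
  by rewrite [dist z y']dist_sym; clear; lia.
have cardXY : #|X1| + #|nbhd 1 Y1| <= 2 ^ n.
  by rewrite -cardsUI (disjoint_setI0 disj) cards0 addn0 -card_cube max_card.
have le_Y1 := subset_leq_card (sub_nbhd 1 Y1).
have iso : (2 * n).+1 * #|Y1| <= 2 * n * #|nbhd 1 Y1|.
  by apply: vertex_isoperimetry; move: bigX1 cardXY le_Y1; clear; lia.
have := evenly_spreadP c spr sepS'; rewrite -/Y1.
have := card_filterS (fun x => f x == c) YY1.
have : #|[set y in nbhd 18 X | f y == c]| + #|[set x in Y | f x == c]| = #|[set x | f x == c]|.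
  rewrite -(cardsID (nbhd 18 X) [set x | f x == c]); congr (_ + _);
    apply: eq_card => x.
    by rewrite !in_set andbC.
  by rewrite !in_set.
have := balanced_card c bal.
set N := 2 ^ n; set g := #|_|; set b := #|_|; set y := #|_|; set y1 := #|_|.
move=> eN eb le_y le_y1.
(* Here 2 y1 <= (1 + 1/(4n)) |Y1| <= (1 + 1/(2n)) |Y1|, which isoperimetry bounds by
   [#|nbhd 1 Y1|]. *)
have le_2y1 : 2 * y1 <= #|nbhd 1 Y1| by move: le_y1 iso n_gt0; clear; nia.
by move: eN eb le_y le_2y1 cardXY; clear; lia.
Qed.

(** * Counting balanced functions and badly spread functions *)

(** With [h = 2 ^ n] this shows that balanced functions on the cube of dimension n + 1 form at least
    a fraction 2^-(n+1) of all functions. *)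
Lemma central_binomial_ge h : 0 < h -> 4 ^ h <= 2 * h * 'C(2 * h, h).
Proof.
elim: h => // -[|h] IHh _ //.
have := IHh isT; set k := h.+1 => {}IHh.
have E : k.+1 * 'C(2 * k.+1, k.+1) = 2 * (2 * k).+1 * 'C(2 * k, k).
  have /= := mul_bin_diag (2 * k).+2 k; have /= := mul_bin_down (2 * k).+1 k.
  rewrite (_ : (2 * k).+1 - k = k.+1); last by lia.
  rewrite (_ : (2 * k).+2 = 2 * k.+1); last by lia.
  by nia.
rewrite expnS; nia.
Qed.

Lemma card_balanced_ge n :
  'C(2 ^ n.+1, 2 ^ n) <= #|[pred f : boolfun n.+1 | balanced f]|.
Proof.
rewrite -card_cube -card_draws.
pose ind (A : {set cube n.+1}) : boolfun n.+1 := [ffun x => x \in A].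
have ind_inj : injective ind.
  by move=> A B /ffunP eqAB; apply/setP => x; have := eqAB x; rewrite !ffunE.
rewrite -(card_imset _ ind_inj);
  apply/subset_leq_card/subsetP => _ /imsetP[A + ->].
rewrite !inE => /eqP cardA; rewrite /balanced.
have -> : #|[pred x | ind A x == true]| = #|A|.
  by apply: eq_card => x; rewrite !inE ffunE eqb_id.
have -> : #|[pred x | ind A x == false]| = #|~: A|.
  by apply: eq_card => x; rewrite !inE ffunE eqbF_neg.
by rewrite -(eqn_add2l #|A|) cardsC card_cube cardA expnS mul2n addnn.
Qed.

(** This binomial theorem sums the union bound over all [S] without grouping them by size. *)
Lemma sum_expr_card (F : realFieldType) (T : finType) (y : F) :
  (\sum_(S : {set T}) y ^+ #|S| = (y + 1) ^+ #|T|)%R.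
Proof.
rewrite -prodr_const (@bigA_distr _ _ 1%R _ _ T (fun=> y) (fun=> 1%R));
  apply: eq_bigr => S _.
by rewrite -prodr_const big_mkcond.
Qed.

(** With y = 1/(2N), Bernoulli gives (1 - y)^N >= 1/2, and (1 + y)^N (1 - y)^N <= 1. *)
Lemma expr1D_le2 (F : realFieldType) (N : nat) :
  0 < N -> (((2 * N)%:R^-1 + 1) ^+ N <= 2 :> F)%R.
Proof.
move=> N_gt0; set y : F := (_^-1)%R.
have N0 : (0 < (2 * N)%:R :> F)%R by rewrite ltr0n; lia.
have y_gt0 : (0 < y)%R by rewrite invr_gt0.
have yN : ((2 * N)%:R * y = 1)%R by rewrite divff // gt_eqF.
have y_le1 : (y <= 1)%R by rewrite invf_le1 // ler1n; lia.
have := @bernoulli F (- y)%R N; rewrite mulNrn -mulr_natl => bern.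
have half : (2^-1 <= (1 - y) ^+ N)%R.
  by apply: le_trans (bern _); move: yN; rewrite ?natrM; lra.
have prod_le : ((y + 1) ^+ N * (1 - y) ^+ N <= 1)%R.
  by rewrite -exprMn exprn_ile1 //; nra.
have : (0 <= (y + 1) ^+ N)%R by rewrite exprn_ge0; lra.
nra.
Qed.

(** Union bound with q = 4n and L = 4n|S|: about n|S| of the exponent pays for the choice of [S],
    and the rest leaves the gain 2^(3n). The 8 collects two colours, a rounding factor 2 and a sum
    over [S] of at most 2. *)
Lemma card_not_evenly_spread n :
  0 < n -> 4 * (4 * n) ^ 2 * (4 * n) <= 'C(n, 4) ->
  #|[set f : boolfun n | ~~ evenly_spread f]| * 2 ^ (3 * n) <= 8 * 2 ^ (2 ^ n).
Proof.
move=> n_gt0 large_n.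
pose B c S := [set f : boolfun n | (4 * n).+1 * #|nbhd 9 S|
                 < 2 * (4 * n) * #|[set x in nbhd 9 S | f x == c]|].
pose scat (S : {set cube n}) := (S != set0) && scattered 8 S.
have cardB c S : scat S -> #|B c S| * 2 ^ (4 * n * #|S|) <= 2 ^ (2 ^ n).
  move=> /andP[_ sepS]; rewrite -(card_cube n); apply: large_deviation.
    by lia.
  have := card_nbhd_scattered (leqnn (4 + 4)) sepS.
  have := subset_leq_card (@nbhd_le n 4 9 S isT).
  by move: 'C(n, 4) large_n => C4; nia.
have coverB : #|[set f : boolfun n | ~~ evenly_spread f]|
              <= \sum_(c : bool) \sum_(S | scat S) #|B c S|.
  under eq_bigr => c _ do under eq_bigr => S _ do rewrite -sum1_card big_mkcond.
  under eq_bigr => c _ do rewrite exchange_big.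
  rewrite exchange_big -sum1_card big_mkcond; apply: leq_sum => f _ /=.
  rewrite inE; case: ifP => // /forallPn[c /forallPn[S]].
  rewrite negb_imply -ltnNge => /andP[sepS bigS].
  (* The empty [S] is never a violation, as both sides of the strict inequality are then 0. *)
  rewrite (bigD1 c) //= (bigD1 S) /=; last first.
    rewrite /scat sepS andbT; apply: contraTneq bigS => ->.
    rewrite -leqNgt [X in _ * X](_ : _ = 0) ?muln0 //.
    apply/eqP; rewrite cards_eq0; apply/eqP/setP => x; rewrite !inE.
    by apply/negP => /andP[/exists_inP[y]]; rewrite inE.
  by rewrite inE bigS.
pose y := ((2 * 2 ^ n)%:R^-1 : rat)%R.
have y_gt0 : (0 < y)%R by rewrite invr_gt0 ltr0n muln_gt0 expn_gt0.
have cardB_le c S : scat S ->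
    (#|B c S|%:R * 2 ^+ (3 * n) <= 2 ^+ (2 ^ n) * 2 * y ^+ #|S|)%R.
  move=> scatS;
    rewrite exprVn ler_pdivlMr ?exprn_gt0 ?ltr0n ?muln_gt0 ?expn_gt0 //.
  have S_gt0 : 0 < #|S| by rewrite card_gt0; case/andP: scatS.
  rewrite -!natrX -!natrM ler_nat -expnS -expnM -mulnA -expnD.
  (* Exponents: 3n + (n + 1)|S| <= 4n|S| + 1 because |S| >= 1. *)
  apply: (@leq_trans (#|B c S| * 2 ^ (4 * n * #|S|).+1)).
    by rewrite leq_mul2l leq_exp2l // orbC; nia.
  by rewrite expnS mulnCA mulnC leq_mul2r cardB.
rewrite -(ler_nat rat) !natrM !natrX.
apply: (@le_trans _ _ (\sum_(c : bool) \sum_(S | scat S) (#|B c S|%:R * 2 ^+ (3 * n))))%R.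
  under eq_bigr => c _ do rewrite -mulr_suml -natr_sum.
  by rewrite -mulr_suml -natr_sum ler_wpM2r ?exprn_ge0 // ler_nat.
apply: (@le_trans _ _ (\sum_(c : bool) \sum_(S : {set cube n}) (2 ^+ (2 ^ n) * 2 * y ^+ #|S|)))%R.
  apply: ler_sum => c _; rewrite [leRHS](bigID scat) /=.
  rewrite -[leLHS]addr0 lerD ?ler_sum ?sumr_ge0 // => [S /(cardB_le c)//|S _].
  by rewrite !mulr_ge0 ?exprn_ge0 ?ltW.
rewrite big_bool /= -mulr_sumr sum_expr_card card_cube.
have := @expr1D_le2 rat (2 ^ n); rewrite expn_gt0 => /(_ isT); rewrite -/y.
have : (0 <= 2 ^+ (2 ^ n) :> rat)%R by rewrite exprn_ge0.
by nra.
Qed.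

(** * Mappings of bounded displacement *)

(** Displacing both endpoints adds at most 2C, and distinct points have distance at least 1. *)
Lemma bilipschitz_of_displacement n C (phi : {perm cube n}) :
  (forall x, dist x (phi x) <= C) -> bilipschitz (2 * C + 1) phi.
Proof.
have lip (psi : cube n -> cube n) :
    (forall x, dist x (psi x) <= C) -> lipschitz_map (2 * C + 1) psi.
  move=> psiC x y; have [->|/dist_gt0] := eqVneq x y; first by rewrite dist_xx.
  have := dist_triangle (psi x) x (psi y); have := dist_triangle x y (psi y).
  have := psiC x; have := psiC y; rewrite [dist (psi x) x]dist_sym; nia.
move=> phiC; split; apply: lip => // x.
by rewrite dist_sym -{2}[x](permKV phi).
Qed.

(** Hall matches each half-cube [H c] into the colour class of [c]. The two matchings glue to an
    injection of a finite set into itself, hence a permutation. *)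
Lemma dictator_mapping n (f : boolfun n.+1) :
  balanced f -> evenly_spread f ->
  exists phi : {perm cube n.+1},
    is_mapping (dictator n) f phi /\ forall x, dist x (phi x) <= 19.
Proof.
move=> bal spr.
pose e : cube n.+1 := [ffun i => i == ord0].
pose H c := [set x : cube n.+1 | x ord0 == c].
have dist_e (x : cube n.+1) : dist x (cube_add x e) <= 1.
  rewrite dist_cube_add (@eq_card _ _ (pred1 ord0)) ?card1 // => i.
  by rewrite !inE ffunE.
have hallH c : exists g : cube n.+1 -> cube n.+1, {in H c &, injective g} /\
    {in H c, forall x, g x \in [set y | f y == c] /\ dist x (g x) <= 19}.
  apply: (@hall _ _ (fun x y => dist x y <= 19) e) => X XH.
  pose X' := (fun x => cube_add x e) @^-1: X.
  have eqX' : #|X'| = #|X| by rewrite card_preimset //;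
    apply: can_inj (cube_addKr e).
  have disj : [disjoint X & X'].
    apply/pred0P => x; apply/negP => /= /andP[/(subsetP XH) + ].
    rewrite inE => /eqP xc; rewrite inE => /(subsetP XH).
    by rewrite inE !ffunE eqxx xc; case: (c).
  have := evenly_spread_hall c (X :|: X') (ltn0Sn n) bal spr.
  have -> : #|X :|: X'| = 2 * #|X|.
    by have := cardsUI X X';
      rewrite (disjoint_setI0 disj) cards0 addn0 eqX' addnn mul2n.
  rewrite leq_pmul2l // => /leq_trans; apply.
  apply/subset_leq_card/subsetP => y;
    rewrite [y \in finset _]in_set => /andP[/nbhdP[x xX xy] fy].
  rewrite !in_set fy /=; apply/exists_inP.
  move: xX; rewrite finset.in_setU => /orP[Xx|]; first by exists x => //; lia.
  rewrite inE => X'x; exists (cube_add x e) => //.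
  have := dist_triangle (cube_add x e) x y; have := dist_e x.
  by rewrite [dist (cube_add x e) x]dist_sym; lia.
have [g1 [inj1 g1P]] := hallH true; have [g0 [inj0 g0P]] := hallH false.
pose g (x : cube n.+1) := if x ord0 then g1 x else g0 x.
have gP x : f (g x) = x ord0 /\ dist x (g x) <= 19.
  rewrite /g; case x0: (x ord0).
    by have [|] := g1P x; rewrite inE ?x0 // => /eqP.
  by have [|] := g0P x; rewrite inE ?x0 // => /eqP.
(* Points of different half-cubes have images of different colours. *)
have g_inj : injective g.
  move=> x y eqg; have eq0 : x ord0 = y ord0 by rewrite -!(gP _).1 eqg.
  move: eqg; rewrite /g -eq0; case x0: (x ord0); [apply: inj1|apply: inj0];
    by rewrite inE -?eq0 x0.
exists (perm g_inj); split=> x; rewrite permE; last exact: (gP x).2.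
by rewrite ffunE (gP x).1.
Qed.

(** * Numerical thresholds and the limit *)

(* Numerals above 5000 in nat are opaque to computation, hence the products. *)
Lemma binomial4_large n : 100 * 100 <= n -> 4 * (4 * n) ^ 2 * (4 * n) <= 'C(n, 4).
Proof.
case: n => [|[|[|[|m]]]] // large_n.
rewrite -(@leq_pmul2r 4`!) // bin_ffact !ffactnS ffactn0 /= muln1.
rewrite (_ : 4`! = 24) //.
(* Here 64 * 96 = 4! * 256. After division by n = m + 4, the claim is 4! * 256 n^2 <= (n - 1)(n -
   2)(n - 3). *)
have sq : 64 * 96 * (m.+4 * m.+4) <= 80 * 100 * (m.+3 * m.+2) by nia.
have : 80 * 100 * (m.+3 * m.+2) <= m.+3 * m.+2 * m.+1
  by rewrite mulnC leq_mul2l; lia.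
move=> /(leq_trans sq) cub.
rewrite (_ : 4 * _ ^ 2 * _ * _ = m.+4 * (64 * 96 * (m.+4 * m.+4))); last by lia.
by rewrite leq_mul2l /=; lia.
Qed.

Lemma expn4_ge n : 8 * n.+3 <= 4 ^ n.+3.
Proof.
elim: n => // n IHn; rewrite expnS.
by apply: leq_trans (leq_mul (leqnn 4) IHn); lia.
Qed.

Lemma pr_balanced_ge (R : realType) n (E : boolfun n.+1 -> Prop) :
  100 * 100 <= n ->
  (forall f, balanced f -> evenly_spread f -> E f) ->
  (1 - harmonic n <= @pr_balanced R n.+1 E <= 1)%R.
Proof.
move=> large_n goodE; rewrite /pr_balanced.
set b := #|[pred f | balanced f]|; set g := #|_|; set d := n.+1.
have le_gb : g <= b.
  by apply/subset_leq_card/subsetP => f; rewrite !inE => /andP[].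
pose u := #|[set f : boolfun d | ~~ evenly_spread f]|.
have le_b : b <= g + u.
  rewrite -cardUI (leq_trans _ (leq_addr _ _)) //.
  apply/subset_leq_card/subsetP => f; rewrite !inE => bal.
  have [spr|_] := boolP (evenly_spread f); rewrite bal /= ?orbT //.
  by rewrite orbF; apply/asboolP/goodE.
(* Bad functions are at most a fraction 8 * 2^(-3d) of all functions; conditioning costs 2^d, and 8
   * 4^(-d) <= 1/d, which is [harmonic n]. *)
have le_d : d * u <= b.
  have ball_large := binomial4_large (leq_trans large_n (leqnSn n)).
  have := card_not_evenly_spread (ltn0Sn n) ball_large; rewrite -/u -/d.
  have centr : 2 ^ (2 ^ d) <= 2 ^ d * 'C(2 ^ d, 2 ^ n).
    have := @central_binomial_ge (2 ^ n); rewrite expn_gt0 => /(_ isT).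
    by rewrite -(expnM 2 2) -!expnS.
  have le_bal : 2 ^ (2 ^ d) <= 2 ^ d * b.
    by rewrite (leq_trans centr) // leq_mul2l card_balanced_ge orbT.
  have le_8d : 8 * d <= 4 ^ d.
    by rewrite /d (_ : n.+1 = (n - 2).+3) ?expn4_ge //; lia.
  rewrite mulnC expnM -[2 ^ 3]/(2 * 4) expnMn => le_u.
  have : u * (2 ^ d * 4 ^ d) <= 2 ^ d * (8 * b).
    by rewrite mulnC (leq_trans le_u) // mulnCA leq_mul2l le_bal.
  rewrite mulnCA leq_pmul2l ?expn_gt0 // => le_u4.
  by rewrite -(@leq_pmul2l 8) // mulnA (leq_trans _ le_u4) //
    mulnC leq_mul2l le_8d orbT.
have b_gt0 : 0 < b.
  by rewrite (leq_trans _ (card_balanced_ge n)) // bin_gt0 leq_exp2l.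
have b_gt0R : (0 < b%:R :> R)%R by rewrite ltr0n.
apply/andP; split; last by rewrite ler_pdivrMr // mul1r ler_nat.
rewrite ler_pdivlMr // /harmonic -/d mulrBl mul1r lerBlDr.
apply: (@le_trans _ _ (g%:R + u%:R)%R); first by rewrite -natrD ler_nat.
by rewrite lerD2l ler_pdivlMl ?ltr0n // -natrM ler_nat.
Qed.

Local Open Scope classical_set_scope.

Theorem theorem1p4 (R : realType) :
  exists C : nat,
    (@pr_balanced R n.+1 (fun f : boolfun n.+1 =>
       exists phi : {perm cube n.+1},
         is_mapping (dictator n) f phi /\
         (forall x : cube n.+1, (dist x (phi x) <= C)%N))
       @[n --> \oo] --> (1%R : R))
    /\
    (forall (n : nat) (f : boolfun n.+1) (phi : {perm cube n.+1}),
       balanced f ->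
       is_mapping (dictator n) f phi ->
       (forall x : cube n.+1, (dist x (phi x) <= C)%N) ->
       bilipschitz (2 * C + 1)%N phi).
Proof.
exists 19; split;
  last by move=> n f phi _ _; apply: bilipschitz_of_displacement.
apply: (@squeeze_cvgr _ _ _ _ (fun n => 1 - harmonic n)%R (fun=> 1%R)).
- near=> n; apply: pr_balanced_ge; last exact: dictator_mapping.
  by near: n; exists (100 * 100).
- rewrite -[X in _ --> X]subr0; apply: cvgB;
  [exact: cvg_cst | exact: cvg_harmonic].
- exact: cvg_cst.
Unshelve. all: by end_near.
Qed.
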